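(* For every odd integer $m\ge 3$, the arc set of the directed Cayley digraph \[ D_5(m)=\operatorname{Cay}\bigl((\mathbb Z_m)^5,\{e_0,e_1,e_2,e_3,e_4\}\bigr) \] decomposes into five directed Hamilton cycles; that is, there are five directed cycles, each of length $m^5$, whose arc sets partition the set of all arcs $x\to x+e_i$ ($x\in(\mathbb Z_m)^5$, $i\in\{0,\dots,4\}$).
   Context: $e_0,\dots,e_4$ denote the standard basis vectors of $(\mathbb Z_m)^5$. The digraph $D_5(m)$ has vertex set $(\mathbb Z_m)^5$ and an arc $x\to x+e_i$ for every vertex $x$ and every $i\in\{0,1,2,3,4\}$ (it is the fifth Cartesian power of the directed $m$-cycle). *)

(* Defs.v *)
From HB Require Import structures.
From mathcomp Require Import all_boot all_order all_algebra.

Set Implicit Arguments.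
Unset Strict Implicit.
Unset Printing Implicit Defensive.

Import GRing.Theory.

Local Open Scope ring_scope.

(* Digraphs are adjacency relations on a finite vertex type; an arc from x to
   y is the pair (x, y). *)
Definition arc_set (T : finType) (e : rel T) : {set T * T} :=
  [set a | e a.1 a.2].

Definition cayley (V : finZmodType) (S : {set V}) : rel V :=
  fun x y => [exists s in S, y == x + s].

(* For 1 < m, 'Z_m is the ring of integers mod m; delta_mx 0 i is e_i. *)
Definition D5 (m : nat) : rel 'rV['Z_m]_5 :=
  cayley [set delta_mx 0 i | i : 'I_5].

(* A directed cycle is the sequence of its distinct vertices in cyclic order,
   the last vertex being followed by the first. *)
Definition hamilton_cycle (T : finType) (e : rel T) (c : seq T) : Prop :=
  ucycle e c /\ forall x : T, x \in c.

Definition cycle_arcs (T : finType) (c : seq T) : {set T * T} :=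
  [set (x, next c x) | x in c].

(* Main.v *)
Require Import Defs.
From HB Require Import structures.
From mathcomp Require Import all_boot all_order all_algebra.

Set Implicit Arguments.
Unset Strict Implicit.
Unset Printing Implicit Defensive.

Import GRing.Theory.

Local Open Scope ring_scope.

(* Colour k follows x |-> x + e_{d_k(x)}, so it suffices to choose directions
   d_k(x), injective in k, for which each of these five maps is a single cycle.
   Every step raises the sum s of the coordinates by 1.  For m >= 5, d_k(x)
   depends only on min(s, 5) and on which coordinates of x vanish, in such a
   way that, for a suitable order p of the coordinates, whether x_{p_j} moves
   is determined by s, x_{p_0}, ..., x_{p_{j-1}}.  The map is then a tower of
   skew products with fibre Z_m over the rotation s |-> s + 1, and a skew
   product over a single cycle is a single cycle as soon as the total increment
   of the fibre is a unit.  Modulo m the increments are +-1, +-2 or +-4, hence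
   units for m odd.  For m = 3, which leaves too few layers for these rules,
   directions that again depend only on s and the vanishing coordinates are
   checked by running the five maps. *)

(** * Single-cycle maps and skew products *)

(** As [T] is finite, such an [f] is a permutation with one cycle through all points. *)
Definition transitive_map (T : finType) (f : T -> T) : Prop :=
  forall x y : T, fconnect f x y.

Lemma transitive_map_fcycle (T : finType) (f : T -> T) (x : T) :
  transitive_map f -> fcycle f (orbit f x).
Proof. by move=> ft; apply/(orbitPcycle 0%N 2%N); apply: ft. Qed.

Lemma transitive_map_orbit (T : finType) (f : T -> T) (x : T) :
  transitive_map f -> perm_eq (orbit f x) (index_enum T).
Proof.
move=> ft; apply: uniq_perm; [exact: orbit_uniq | exact: index_enum_uniq |].
by move=> y; rewrite mem_index_enum -fconnect_orbit; apply: ft.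
Qed.

(** The number of [g]-steps from [phi x] to [phi y] also leads [f] from [x] to [y], by injectivity
    of [phi]. *)
Lemma transitive_map_semiconj (T U : finType) (f : T -> T) (g : U -> U)
    (phi : T -> U) :
  injective phi -> (forall x, phi (f x) = g (phi x)) ->
  transitive_map g -> transitive_map f.
Proof.
move=> phi_inj phiE gt x y.
have iterE n : phi (iter n f x) = iter n g (phi x).
  by elim: n => //= n <-.
suff <- : iter (findex g (phi x) (phi y)) f x = y by apply: fconnect_iter.
by apply: phi_inj; rewrite iterE iter_findex.
Qed.

Lemma transitive_map_succ (m : nat) : transitive_map (fun s : 'Z_m => s + 1).
Proof.
move=> s t.
have iterE n : iter n (fun s : 'Z_m => s + 1) s = s + n%:R.
  by elim: n => [|n /= ->]; rewrite ?addr0 // -addrA -natr1.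
suff <- : iter (t - s)%R (fun s : 'Z_m => s + 1) s = t by apply: fconnect_iter.
by rewrite iterE natr_Zp addrC subrK.
Qed.

Definition skew (T : Type) (V : zmodType) (g : T -> T) (h : T -> V)
  (t : T * V) : T * V := (g t.1, t.2 + h t.1).

Lemma iter_skew (T : Type) (V : zmodType) (g : T -> T) (h : T -> V) n t :
  iter n (skew g h) t
    = (iter n g t.1, t.2 + \sum_(u <- traject g t.1 n) h u).
Proof.
elim: n t => [|n IHn] t; first by rewrite big_nil addr0 -surjective_pairing.
by rewrite iterSr IHn /= big_cons addrA -iterSr.
Qed.

(* Going once around the base adds the total increment of [h] to the fibre. *)
Lemma transitive_map_skew (T : finType) (m : nat) (g : T -> T)
    (h : T -> 'Z_m) :
  transitive_map g -> \sum_t h t \is a GRing.unit ->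
  transitive_map (skew g h).
Proof.
move=> gt; set w := \sum_t h t => w_unit [s u] [t v].
have round k u' : fconnect (skew g h) (t, u') (t, u' + w *+ k).
  elim: k u' => [|k IHk] u'; first by rewrite addr0.
  apply: connect_trans (_ : fconnect _ (t, u' + w) _); last first.
    by rewrite mulrS addrA.
  suff <- : iter (order g t) (skew g h) (t, u') = (t, u' + w).
    exact: fconnect_iter.
  rewrite iter_skew /=; congr (_, u' + _).
    by apply/(orbitPcycle 0%N 4%N); apply: transitive_map_fcycle.
  exact/perm_big/transitive_map_orbit.
(* First reach [t] in the base; then [w^-1 * (v - u')] full rounds, this residue being read as a
   natural number, correct the fibre. *)
apply: connect_trans (fconnect_iter _ (findex g s t) _) _.
rewrite iter_skew /= iter_findex //.
set u' := u + _; suff -> : v = u' + w *+ (w^-1 * (v - u'))%R by apply: round.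
by rewrite -mulr_natr natr_Zp mulVKr // addrC subrK.
Qed.

(** * From direction rules to Hamilton decompositions *)

(** Different colours leave a vertex in different directions, so their arcs are disjoint; with as
    many colours as directions, each arc is used. *)
Lemma decomposition_of_directions (m : nat)
    (d : 'I_5 -> 'rV['Z_m]_5 -> 'I_5) :
  (1 < m)%N -> (forall x, injective (d^~ x)) ->
  (forall k, transitive_map (fun x : 'rV['Z_m]_5 => x + delta_mx 0 (d k x))) ->
  exists C : 'I_5 -> seq 'rV['Z_m]_5,
    [/\ forall k : 'I_5,
          hamilton_cycle (@D5 m) (C k) /\ size (C k) = (m ^ 5)%N,
        forall k l : 'I_5, k != l ->
          [disjoint cycle_arcs (C k) & cycle_arcs (C l)]
      & \bigcup_(k : 'I_5) cycle_arcs (C k) = arc_set (@D5 m)].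
Proof.
move=> m_gt1 d_inj ft0; pose f k (x : 'rV['Z_m]_5) := x + delta_mx 0 (d k x).
have ft k : transitive_map (f k) := ft0 k.
pose C k := orbit (f k) 0.
have Ccyc k : fcycle (f k) (C k) by apply: transitive_map_fcycle.
have Cmem k x : x \in C k.
  by rewrite (perm_mem (transitive_map_orbit 0 (ft k))) mem_index_enum.
have arcs k x y : ((x, y) \in cycle_arcs (C k)) = (y == f k x).
  apply/imsetP/eqP => [[z _ [-> ->]] | ->].
    exact: nextE (Ccyc k) _ (Cmem k z).
  by exists x => //; rewrite (nextE (Ccyc k)).
have delta_inj (i j : 'I_5) :
    delta_mx 0 i = delta_mx 0 j :> 'rV['Z_m]_5 -> i = j.
  move/matrixP/(_ 0 i); rewrite !mxE !eqxx /= => /eqP.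
  by case: (eqVneq i j) => // _; rewrite oner_eq0.
have D5E x y : (D5 x y) = [exists i, y == x + delta_mx 0 i].
  apply/existsP/existsP => [[e /andP[/imsetP[i _ ->] /eqP ->]] | [i /eqP ->]].
    by exists i.
  by exists (delta_mx 0 i); rewrite imset_f /=.
exists C; split=> [k | k l neq_kl |].
- split.
    split=> //; apply/andP; split; last exact: orbit_uniq.
    apply: sub_cycle (Ccyc k) => x y /eqP <-; rewrite D5E.
    by apply/existsP; exists (d k x).
  rewrite size_orbit.
  have := perm_size (transitive_map_orbit 0 (ft k)).
  rewrite size_orbit => ->.
  by rewrite [index_enum _]unlock -enumT -cardT card_mx card_ord Zp_cast ?mul1n.
- rewrite -setI_eq0; apply/eqP/setP => -[x y]; rewrite !inE !arcs.
  apply/negbTE/andP => -[/eqP -> /eqP /addrI /delta_inj /d_inj].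
  exact/eqP.
- apply/setP => -[x y]; rewrite inE /= D5E; apply/bigcupP/existsP.
    by case=> k _; rewrite arcs => /eqP ->; exists (d k x).
  case=> i /eqP ->; have [d' _ dK] := injF_bij (d_inj x).
  by exists (d' i) => //; rewrite arcs /f dK.
Qed.

(** * Triangular rules as towers of skew products *)

Lemma sum_Zp_nat (m : nat) (V : nmodType) (F : nat -> V) : (1 < m)%N ->
  \sum_(s : 'Z_m) F s = \sum_(0 <= i < m) F i.
Proof. by move=> m_gt1; rewrite -(big_mkord predT F) Zp_cast. Qed.

Section Triangular.

Variables (m n K : nat) (dir : nat -> seq bool -> nat) (p : seq nat).

Definition zeros (x : 'rV['Z_m]_n.+1) : seq bool :=
  mkseq (fun i => x 0 (inord i) == 0) n.+1.

Definition step (x : 'rV['Z_m]_n.+1) : 'rV['Z_m]_n.+1 :=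
  x + delta_mx 0 (inord (dir (minn (\sum_i x 0 i)%R K) (zeros x))).

(* [zs] lists the tests in the order [p]; the tests that it does not contain
   read [true]. *)
Definition unsort (zs : seq bool) : seq bool :=
  mkseq (fun i => nth true zs (index i p)) n.+1.

Definition moves (c : nat) (zs : seq bool) (j : nat) : bool :=
  dir c (unsort zs) == nth 0%N p j.

(** Sum over the words of length [j], signed by the parity of the number of [false]: the m - 1
    nonzero residues weigh -1 modulo m. *)
Fixpoint bit_sum (j : nat) (F : seq bool -> int) : int :=
  if j is j'.+1 then
    bit_sum j' (fun zs => F (rcons zs true) - F (rcons zs false))
  else F [::].

(* The total increment, modulo m, of coordinate [p_j] over a period of the
   coordinates before it: m - 1 of the m values of a coordinate are nonzero,
   and m - K of the m layers behave as layer [K]. *)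
Definition drift (j : nat) : int :=
  let layer_sum c := bit_sum j (fun zs => (moves c zs j : nat)%:Z) in
  foldr +%R 0 [seq layer_sum c | c <- iota 0 K] - layer_sum K *+ K.

(** The base is the coordinate sum; the fibres are the coordinates p_0, ..., p_{j-1}. With the sum
    known, level [n] already determines the vector. *)
Fixpoint tower (j : nat) : finType :=
  if j is j'.+1 then (tower j' * 'Z_m)%type else 'Z_m.

Fixpoint tower_layer (j : nat) : tower j -> nat :=
  if j is j'.+1 then fun t => tower_layer t.1 else fun s => minn s K.

Fixpoint tower_zeros (j : nat) : tower j -> seq bool :=
  if j is j'.+1 then fun t => rcons (tower_zeros t.1) (t.2 == 0)
  else fun => [::].

Fixpoint tower_step (j : nat) : tower j -> tower j :=
  if j is j'.+1 then
    skew (@tower_step j') (fun t =>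
      (moves (tower_layer t) (tower_zeros t) j' : nat)%:R)
  else fun s => s + 1.

Fixpoint tower_coords (j : nat) (x : 'rV['Z_m]_n.+1) : tower j :=
  if j is j'.+1 then (tower_coords j' x, x 0 (inord (nth 0%N p j')))
  else \sum_i x 0 i.

Lemma sum_zero_test (F : bool -> int) : (1 < m)%N ->
  \sum_(u : 'Z_m) (F (u == 0))%:~R = (F true - F false)%:~R :> 'Z_m.
Proof.
move=> m_gt1; rewrite (bigD1 0) //= (eq_bigr (fun=> (F false)%:~R)) => [|u].
  have card_nz : #|predC1 (0 : 'Z_m)| = m.-1.
    by rewrite cardC1 card_ord Zp_cast.
  rewrite sumr_const card_nz eqxx -mulr_natr -subn1 natrB ?(ltnW m_gt1) //.
  by rewrite pchar_Zp // sub0r mulrN1 rmorphB.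
by move/negbTE=> ->.
Qed.

Lemma sum_layers (F : nat -> int) : (1 < m)%N -> (K <= m)%N ->
  \sum_(s : 'Z_m) (F (minn s K))%:~R
    = (foldr +%R 0 [seq F c | c <- iota 0 K] - F K *+ K)%:~R :> 'Z_m.
Proof.
move=> m_gt1 le_Km.
rewrite (sum_Zp_nat (fun i => (F (minn i K))%:~R)) // (big_cat_nat _ le_Km) //=.
rewrite foldrE big_map rmorphB rmorph_sum /=; congr (_ + _).
  rewrite /index_iota subn0 big_seq [RHS]big_seq; apply: eq_bigr => i.
  by rewrite mem_iota add0n /= => /ltnW /minn_idPl ->.
rewrite (eq_big_nat _ _ (F2 := fun=> (F K)%:~R)) => [|i /andP[le_Ki _]].
  rewrite sumr_const_nat mulrnBr // rmorphMn -[X in X - _]mulr_natr.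
  by rewrite pchar_Zp // mulr0 sub0r.
by rewrite (minn_idPr le_Ki).
Qed.

(** Summing out the top fibre replaces [F] by the difference that [bit_sum] takes; the layers remain
    at the bottom. *)
Lemma sum_tower (j : nat) (F : nat -> seq bool -> int) :
  (1 < m)%N -> (K <= m)%N ->
  \sum_(t : tower j) (F (tower_layer t) (tower_zeros t))%:~R
    = (foldr +%R 0 [seq bit_sum j (F c) | c <- iota 0 K]
        - bit_sum j (F K) *+ K)%:~R :> 'Z_m.
Proof.
move=> m_gt1 le_Km; elim: j F => [|j IHj] F.
  exact: (sum_layers (fun c => F c [::])).
rewrite -(IHj (fun c zs => F c (rcons zs true) - F c (rcons zs false))).
rewrite -(pair_bigA _ (fun t u =>
  (F (tower_layer t) (rcons (tower_zeros t) (u == 0)))%:~R)) /=.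
by apply: eq_bigr => t _; apply: (sum_zero_test (fun b => F _ (rcons _ b))).
Qed.

Lemma transitive_tower_step (j : nat) : (1 < m)%N -> (K <= m)%N ->
  (forall i, (i < j)%N -> coprime m `|drift i|) ->
  transitive_map (@tower_step j).
Proof.
move=> m_gt1 le_Km; elim: j => [|j IHj] drift_unit /=.
  exact: transitive_map_succ.
apply: transitive_map_skew.
  by apply: IHj => i lt_ij; apply: drift_unit; apply: leqW.
rewrite (sum_tower j (fun c zs => (moves c zs j : nat)%:Z)) // -/(drift j).
have := drift_unit j (leqnn _); rewrite -unitZpE //.
(* The unit criterion concerns naturals, hence the split on the sign of the drift. *)
by case: (intP (drift j)) => [|i|i] //; rewrite ?rmorphN /= ?unitrN.
Qed.

Hypothesis p_perm : perm_eq p (iota 0 n.+1).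

Lemma mem_order (i : nat) : (i \in p) = (i <= n)%N.
Proof. by rewrite (perm_mem p_perm) mem_iota add0n. Qed.

Lemma size_order : size p = n.+1.
Proof. by rewrite (perm_size p_perm) size_iota. Qed.

Lemma unsort_zeros (x : 'rV['Z_m]_n.+1) :
  unsort [seq x 0 (inord i) == 0 | i <- p] = zeros x.
Proof.
apply/eq_in_map => i; rewrite mem_iota add0n /= => le_in.
by rewrite (nth_map 0%N) ?nth_index ?index_mem // mem_order.
Qed.

Lemma tower_layer_coords (j : nat) (x : 'rV['Z_m]_n.+1) :
  tower_layer (tower_coords j x) = minn (\sum_i x 0 i)%R K.
Proof. by elim: j. Qed.

Lemma tower_zeros_coords (j : nat) (x : 'rV['Z_m]_n.+1) : (j <= n)%N ->
  tower_zeros (tower_coords j x) = take j [seq x 0 (inord i) == 0 | i <- p].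
Proof.
elim: j => [|j IHj] lt_jn /=; first by rewrite take0.
rewrite IHj ?(ltnW lt_jn) // (take_nth true) ?size_map ?size_order; last first.
  exact: leqW.
by rewrite (nth_map 0%N) // size_order leqW.
Qed.

Lemma tower_coords_inj : injective (tower_coords n).
Proof.
move=> x y eq_xy.
have eq_p j : (j <= n)%N -> tower_coords j x = tower_coords j y ->
    \sum_i x 0 i = \sum_i y 0 i
    /\ forall i, (i < j)%N ->
         x 0 (inord (nth 0%N p i)) = y 0 (inord (nth 0%N p i)).
  elim: j => [|j IHj] // lt_jn [eq_t eqj].
  have [eq_s eq_j] := IHj (ltnW lt_jn) eq_t.
  split=> // i; rewrite ltnS leq_eqVlt => /predU1P[-> //|]; exact: eq_j.
have [eq_s {}eq_p] := eq_p n (leqnn n) eq_xy.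
have eq_i (i : 'I_n.+1) : i != inord (nth 0%N p n) -> x 0 i = y 0 i.
  move=> ne_in; have i_p : (i : nat) \in p by rewrite mem_order -ltnS.
  rewrite -[i]inord_val -(nth_index 0%N i_p); apply: eq_p.
  have := i_p; rewrite -index_mem size_order ltnS leq_eqVlt.
  case/predU1P => [eq_in|//].
  by case/eqP: ne_in; rewrite -[X in nth _ _ X]eq_in nth_index // inord_val.
set last_p := inord (nth 0%N p n) in eq_i.
apply/rowP => i; have [-> | /eq_i //] := eqVneq i last_p.
(* The coordinate missing from the tower is recovered from the sum. *)
move: eq_s; rewrite (bigD1 last_p) //= [RHS](bigD1 last_p) //=.
by rewrite (eq_bigr _ eq_i) => /addIr.
Qed.

Hypothesis dir_le : forall c zs, (dir c zs <= n)%N.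
(** As absent tests read [true], this says that the tests from position [j] on do not affect whether
    p_j moves. *)
Hypothesis dir_triangular : forall c zs j,
  (c <= K)%N -> size zs = n.+1 -> (j < n)%N ->
  moves c zs j = moves c (take j zs) j.

(** Any direction raises the sum by 1, and by triangularity the motion of each p_j is read off the
    level below. *)
Lemma tower_coords_step (x : 'rV['Z_m]_n.+1) (j : nat) : (j <= n)%N ->
  tower_coords j (step x) = tower_step (tower_coords j x).
Proof.
elim: j => [_|j IHj lt_jn] /=.
  rewrite (eq_bigr _ (fun i _ => mxE _ _ _ _)) big_split /=; congr (_ + _).
  set d := inord _; rewrite (bigD1 d) //=.
  rewrite big1 => [|i /negbTE ne_i]; first by rewrite mxE !eqxx addr0.
  by rewrite mxE ne_i andbF.
rewrite /skew /= IHj ?(ltnW lt_jn) //; congr (_, _).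
rewrite tower_layer_coords tower_zeros_coords ?(ltnW lt_jn) //.
rewrite -dir_triangular //.
- rewrite /moves unsort_zeros !mxE eqxx /=; congr (_ + (nat_of_bool _)%:R).
  rewrite eq_sym -val_eqE /= !inordK ?ltnS ?dir_le //.
  by rewrite -mem_order mem_nth // size_order leqW.
- exact: geq_minr.
- by rewrite size_map size_order.
Qed.

Lemma transitive_step : (1 < m)%N -> (K <= m)%N ->
  (forall j, (j < n)%N -> coprime m `|drift j|) ->
  transitive_map step.
Proof.
move=> m_gt1 le_Km /(transitive_tower_step m_gt1 le_Km).
apply: transitive_map_semiconj tower_coords_inj _ => x.
exact: tower_coords_step.
Qed.

End Triangular.

(** * Explicit rules for odd m at least 5 *)

Fixpoint words (T : Type) (A : seq T) (n : nat) : seq (seq T) :=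
  if n is n'.+1 then [seq a :: w | a <- A, w <- words A n'] else [:: [::]].

Lemma mem_words (T : eqType) (A w : seq T) :
  all [in A] w -> w \in words A (size w).
Proof. by elim: w => //= a w IHw /andP[Aa /IHw Aw]; apply: allpairs_f. Qed.

Definition bit_words (n : nat) : seq (seq bool) := words [:: true; false] n.

Lemma mem_bit_words (zs : seq bool) : zs \in bit_words (size zs).
Proof. by apply: mem_words; apply/allP => -[]. Qed.

(* [(a, b, s)]: move along [b] where all coordinates in [s] vanish, along [a]
   elsewhere. *)
Definition rule : Type := (nat * nat * seq nat)%type.

Definition rule_dir (r : rule) (zs : seq bool) : nat :=
  let: (a, b, s) := r in if all (nth true zs) s then b else a.

(* Row c, column k is the rule of colour k in layer c; the last row serves all
   layers from 5 on. Found by computer search. *)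
Definition rules : seq (seq rule) :=
  [:: [:: (2, 1, [:: 4]); (3, 0, [:: 1; 2; 4]); (4, 4, [::]);
          (1, 2, [:: 4]); (0, 3, [:: 1; 2; 4])];
      [:: (3, 0, [:: 1; 2; 4]); (4, 4, [::]); (2, 1, [:: 4]);
          (1, 2, [:: 4]); (0, 3, [:: 1; 2; 4])];
      [:: (1, 3, [:: 2; 4]); (3, 1, [:: 2; 4]); (2, 0, [:: 1; 3; 4]);
          (0, 2, [:: 1; 3; 4]); (4, 4, [::])];
      [:: (4, 4, [::]); (0, 1, [:: 2; 4]); (2, 3, [:: 1; 4]);
          (3, 2, [:: 1; 4]); (1, 0, [:: 2; 4])];
      [:: (3, 0, [:: 4]); (2, 1, [:: 4]); (0, 3, [:: 4]);
          (4, 4, [::]); (1, 2, [:: 4])];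
      [:: (4, 4, [::]); (1, 1, [::]); (3, 3, [::]);
          (2, 2, [::]); (0, 0, [::])]]%N.

(* The order of the coordinates that makes each colour triangular. *)
Definition orders : seq (seq nat) :=
  [:: [:: 4; 2; 1; 0; 3]; [:: 4; 2; 1; 0; 3]; [:: 4; 1; 3; 0; 2];
      [:: 4; 1; 3; 0; 2]; [:: 4; 2; 1; 0; 3]]%N.

Definition rules_dir (k c : nat) (zs : seq bool) : nat :=
  rule_dir (nth (0, 0, [::])%N (nth [::] rules c) k) zs.

Lemma rules_dir_le (k c : nat) (zs : seq bool) : (rules_dir k c zs <= 4)%N.
Proof.
rewrite /rules_dir /rule_dir.
case: c => [|[|[|[|[|[|c]]]]]]; case: k => [|[|[|[|[|k]]]]] //=;
  by rewrite ?nth_nil //; case: ifP.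
Qed.

Lemma rules_dir_inj (c k l : nat) (zs : seq bool) :
  (c <= 5)%N -> size zs = 5%N -> (k < 5)%N -> (l < 5)%N ->
  rules_dir k c zs = rules_dir l c zs -> k = l.
Proof.
move=> le_c5 size_zs lt_k5 lt_l5 eq_kl.
(* Six layers and 32 zero patterns exhaust the cases. *)
have : all (fun c => all (fun zs =>
    uniq [seq rules_dir k c zs | k <- iota 0 5]) (bit_words 5)) (iota 0 6).
  by vm_compute.
move/allP/(_ c); rewrite mem_iota => /(_ le_c5) /allP/(_ zs).
rewrite -{1}size_zs mem_bit_words => /(_ isT) /uniqP-/(_ 0%N).
move/(_ k l); rewrite !inE !size_map size_iota => /(_ lt_k5 lt_l5).
by rewrite !(nth_map 0%N) ?size_iota // !nth_iota //; apply.
Qed.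

Lemma rules_triangular (k c : nat) (zs : seq bool) (j : nat) :
  (k < 5)%N -> (c <= 5)%N -> size zs = 5%N -> (j < 4)%N ->
  let p := nth [::] orders k in
  moves 4 (rules_dir k) p c zs j = moves 4 (rules_dir k) p c (take j zs) j.
Proof.
move=> lt_k5 le_c5 size_zs lt_j4 /=.
have : all (fun k => let p := nth [::] orders k in
    all (fun c => all (fun zs => all (fun j =>
      moves 4 (rules_dir k) p c zs j
        == moves 4 (rules_dir k) p c (take j zs) j)
    (iota 0 4)) (bit_words 5)) (iota 0 6)) (iota 0 5).
  by vm_compute.
move/allP/(_ k); rewrite mem_iota => /(_ lt_k5) /allP/(_ c).
rewrite mem_iota => /(_ le_c5) /allP/(_ zs).
rewrite -{1}size_zs mem_bit_words => /(_ isT) /allP/(_ j).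
by rewrite mem_iota => /(_ lt_j4) /eqP.
Qed.

(** The integer [drift] does not involve [m], so one computation serves every odd modulus. *)
Lemma rules_drift (m k j : nat) : odd m -> (k < 5)%N -> (j < 4)%N ->
  coprime m `|drift 4 5 (rules_dir k) (nth [::] orders k) j|.
Proof.
move=> m_odd lt_k5 lt_j4.
have : all (fun k => all (fun j =>
    `|drift 4 5 (rules_dir k) (nth [::] orders k) j|%N \in [:: 1; 2; 4]%N)
    (iota 0 4)) (iota 0 5).
  by vm_compute.
move/allP/(_ k); rewrite mem_iota => /(_ lt_k5) /allP/(_ j).
rewrite mem_iota => /(_ lt_j4); rewrite !inE => /or3P[] /eqP ->.
- exact: coprimen1.
- by rewrite coprimen2.
- by rewrite (@coprimeXr 2 m 2) ?coprimen2.
Qed.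

Lemma transitive_rules (m k : nat) :
  (5 <= m)%N -> odd m -> (k < 5)%N ->
  transitive_map (@step m 4 5 (rules_dir k)).
Proof.
move=> m_ge5 m_odd lt_k5.
apply: (@transitive_step m 4 5 _ (nth [::] orders k)) => //.
- by case: k lt_k5 => [|[|[|[|[|k]]]]].
- exact: rules_dir_le.
- by move=> c zs j le_c5 size_zs lt_j4; apply: rules_triangular.
- exact: leq_trans m_ge5.
- by move=> j lt_j4; apply: rules_drift.
Qed.

(** * The case m = 3 by computation *)

(* For m = 3 the five colours are the rotations of a single one. Found by
   computer search. *)
Definition base_dir3 (c : nat) (zs : seq bool) : nat :=
  let z := nth true zs in
  match c with
  | 0 => if z 1 && z 2 && ~~ z 4 then 0
         else if z 0 && z 4 && ~~ z 2 then 1 else 3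
  | 1 => 0
  | _ => if (z 0 == z 3) && (z 3 == z 4) then 2
         else if (z 0 != z 3) && (z 2 == z 3) then 4 else 1
  end%N.

(** The base rule conjugated by the cyclic shift of the coordinates by [k]. *)
Definition dir3 (k c : nat) (zs : seq bool) : nat :=
  ((k + base_dir3 c (rot k zs)) %% 5)%N.

(** Vectors become lists of naturals, on which [vm_compute] can run the maps. *)
Definition coords3 (x : 'rV['Z_3]_5) : seq nat :=
  mkseq (fun i => x 0 (inord i) : nat) 5.

Definition layer3 (w : seq nat) : nat := (sumn w %% 3)%N.

Definition zeros3 (w : seq nat) : seq bool := [seq a == 0%N | a <- w].

Definition step3 (k : nat) (w : seq nat) : seq nat :=
  let i := dir3 k (layer3 w) (zeros3 w) in
  set_nth 0%N w i ((nth 0%N w i).+1 %% 3)%N.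

Definition words3 : seq (seq nat) := words [:: 0; 1; 2]%N 5.

(** Checked on the 243 vectors, hence only for layers and zero patterns that occur together. *)
Lemma dir3_inj (w : seq nat) (k l : nat) :
  w \in words3 -> (k < 5)%N -> (l < 5)%N ->
  dir3 k (layer3 w) (zeros3 w) = dir3 l (layer3 w) (zeros3 w) -> k = l.
Proof.
move=> w_in lt_k5 lt_l5 eq_kl.
have : all (fun w => uniq [seq dir3 k (layer3 w) (zeros3 w) | k <- iota 0 5])
    words3.
  by vm_compute.
move/allP/(_ w w_in)/uniqP => /(_ 0%N k l).
rewrite !inE !size_map size_iota => /(_ lt_k5 lt_l5).
by rewrite !(nth_map 0%N) ?size_iota // !nth_iota //; apply.
Qed.

Lemma coords3_words (x : 'rV['Z_3]_5) : coords3 x \in words3.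
Proof.
apply: (mem_words (w := coords3 x)); apply/allP => _ /mapP[i _ ->].
by case: (x 0 (inord i)) => -[|[|[|]]].
Qed.

Lemma coords3_inj : injective coords3.
Proof.
move=> x y eq_xy; apply/rowP => i; apply/val_inj => /=.
have := congr1 (fun w => nth 0%N w i) eq_xy.
by rewrite !nth_mkseq // inord_val.
Qed.

Lemma zeros3_coords (x : 'rV['Z_3]_5) : zeros3 (coords3 x) = zeros x.
Proof. by rewrite /zeros3 -map_comp; apply: eq_map. Qed.

(** The cap 3 is never reached by a residue modulo 3, so the layer is the sum itself. *)
Lemma layer3_coords (x : 'rV['Z_3]_5) :
  layer3 (coords3 x) = minn (\sum_i x 0 i)%R 3.
Proof.
have -> : \sum_i x 0 i = (sumn (coords3 x))%:R.
  rewrite sumnE big_map natr_sum.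
  rewrite (eq_bigr (fun i : 'I_5 => (x 0 (inord i) : nat)%:R)).
    by rewrite -(big_mkord predT (fun i => (x 0 (inord i) : nat)%:R)).
  by move=> i _; rewrite inord_val natr_Zp.
rewrite val_Zp_nat //; apply/esym/minn_idPl/ltnW; exact: ltn_pmod.
Qed.

Lemma coords3_step (k : nat) (x : 'rV['Z_3]_5) :
  coords3 (step 3 (dir3 k) x) = step3 k (coords3 x).
Proof.
rewrite /step3 layer3_coords zeros3_coords /step; set d := dir3 _ _ _.
have lt_d5 : (d < 5)%N by apply: ltn_pmod.
apply: (eq_from_nth (x0 := 0%N)) => [|i].
  by rewrite size_set_nth !size_mkseq (maxn_idPr lt_d5).
rewrite size_mkseq => lt_i5; rewrite nth_set_nth /= nth_mkseq // !mxE eqxx /=.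
rewrite -val_eqE /= !inordK // eq_sym; have [-> | _] := eqVneq d i.
  by rewrite nth_mkseq // -[(nat_of_ord _).+1]addn1.
by rewrite nth_mkseq //= addn0 modn_small // ltn_ord.
Qed.

Lemma transitive_dir3 (k : nat) :
  (k < 5)%N -> transitive_map (@step 3 4 3 (dir3 k)).
Proof.
move=> lt_k5; set f := step _ _.
have iterE n x : coords3 (iter n f x) = iter n (step3 k) (coords3 x).
  by elim: n => //= n <-; rewrite coords3_step.
(* There are 243 = 3^5 vertices; the orbit of the origin must meet all of them and close up. *)
have : all (fun k => (iter 243 (step3 k) (nseq 5 0%N) == nseq 5 0%N) &&
    all [in traject (step3 k) (nseq 5 0%N) 243] words3) (iota 0 5).
  by vm_compute.
move/allP/(_ k); rewrite mem_iota => /(_ lt_k5).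
(* Abstracting the number keeps the iterates from being unfolded below. *)
move: 243%N => N /andP[/eqP loop /allP reach].
have coords0 : coords3 0 = nseq 5 0%N by rewrite /coords3 /mkseq /= !mxE.
have reach0 x : exists2 i, (i < N)%N & x = iter i f 0.
  have /trajectP[i lt_i eq_x] := reach _ (coords3_words x).
  by exists i => //; apply: coords3_inj; rewrite iterE coords0.
move=> x y; have [i lt_i ->] := reach0 x; have [j _ ->] := reach0 y.
(* From [x], complete the loop back to 0, then follow it to [y]. *)
suff {2}-> : 0 = iter (N - i) f (iter i f 0).
  by rewrite -iterD; exact: fconnect_iter.
apply: coords3_inj; rewrite -iterD (subnK (ltnW lt_i)).
by rewrite [RHS]iterE coords0 [RHS]loop.
Qed.

Theorem mainTheorem1 (m : nat) (m_ge3 : (3 <= m)%N) (m_odd : odd m) :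
  exists C : 'I_5 -> seq 'rV['Z_m]_5,
    [/\ forall k : 'I_5,
          hamilton_cycle (@D5 m) (C k) /\ size (C k) = (m ^ 5)%N,
        forall k l : 'I_5, k != l ->
          [disjoint cycle_arcs (C k) & cycle_arcs (C l)]
      & \bigcup_(k : 'I_5) cycle_arcs (C k) = arc_set (@D5 m)].
Proof.
have [m_ge5 | m_lt5] := leqP 5 m.
  apply: (@decomposition_of_directions m (fun k x =>
    inord (rules_dir k (minn (\sum_i x 0 i)%R 5) (zeros x)))).
  - exact: leq_trans m_ge3.
  - move=> x k l /(congr1 val); rewrite /= !inordK ?ltnS ?rules_dir_le //.
    by move/rules_dir_inj => eq_kl; apply/val_inj/eq_kl;
      rewrite ?geq_minr ?size_mkseq.
  - by move=> k; apply: transitive_rules.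
have {m_ge3 m_lt5 m_odd} -> : m = 3%N.
  by case: m m_ge3 m_odd m_lt5 => [|[|[|[|[]]]]].
apply: (@decomposition_of_directions 3 (fun k x =>
  inord (dir3 k (minn (\sum_i x 0 i)%R 3) (zeros x)))) => //.
- move=> x k l /(congr1 val); rewrite /= !inordK ?ltn_pmod //.
  by rewrite -layer3_coords -zeros3_coords => /dir3_inj eq_kl;
    apply/val_inj/eq_kl; rewrite ?coords3_words.
- by move=> k; apply: transitive_dir3.
Qed.
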